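(* Let $G$ be a finite group, let $I$ and $\Lambda$ be finite (non-empty) index sets, and let $P=(p_{\lambda i})$ be a regular $\Lambda\times I$ matrix with entries in $G^0$ that contains at least one zero entry. Suppose that $\mathcal{G}(\mathcal{M}_0[G;I,\Lambda;P])$ is not connected. Let $Q=P[\Lambda_Q|I_Q]$ and $M=P[\Lambda_M|I_M]$ be distinct $0$-closure submatrices of $P$. Let $\mathcal{C}_Q$ and $\mathcal{C}_M$ be the (distinct) connected components of $\mathcal{G}(\mathcal{M}_0[G;I,\Lambda;P])$ determined by $Q$ and by $M$, respectively, and let $\mathcal{C}_{QM}$ be the connected component of $\mathcal{G}(\mathcal{M}_0[G;I,\Lambda;P])$ determined by $Q$ and $M$. Then (1) If $|I_Q|=|\Lambda_Q|=|I_M|=|\Lambda_M|=1$ and $G$ is a non-trivial abelian group, then $\mathrm{diam}(\mathcal{C}_{QM})=1$. (2) Otherwise, $\mathrm{diam}(\mathcal{C}_{QM})=1+\max\{\mathrm{diam}(\mathcal{C}_Q),\mathrm{diam}(\mathcal{C}_M)\}$.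
   Context: $G^0=G\cup\{0\}$ is $G$ with a zero adjoined. A matrix over $G^0$ is regular if every row and every column contains a non-zero entry. The $0$-Rees matrix semigroup $\mathcal{M}_0[G;I,\Lambda;P]$ is the set $(I\times G\times\Lambda)\cup\{0\}$ with $(i,x,\lambda)(j,y,\mu)=(i,xp_{\lambda j}y,\mu)$ if $p_{\lambda j}\neq 0$, $(i,x,\lambda)(j,y,\mu)=0$ if $p_{\lambda j}=0$, and all products involving $0$ equal to $0$. The commuting graph $\mathcal{G}(S)$ of a finite non-commutative semigroup $S$ is the simple graph with vertex set $S\setminus Z(S)$ ($Z(S)$ the center), where distinct $x,y$ are adjacent iff $xy=yx$. (When $P$ is regular and has a zero entry, $\mathcal{M}_0[G;I,\Lambda;P]$ is non-commutative with center $\{0\}$.) $\mathrm{diam}$ is the maximum distance between two vertices. For $I'\subseteq I$, $\Lambda'\subseteq\Lambda$, $P[\Lambda'|I']$ is the submatrix of $P$ with rows indexed by $\Lambda'$ and columns by $I'$. $0$-closure method: let $p_{\lambda i}=0$. Put $I_0=\{i\}$, $\Lambda_0=\{\lambda\}$ and, for $k\ge 0$, $I_{k+1}=I_k\cup\{j\in I: p_{\mu j}=0\text{ for some }\mu\in\Lambda_k\}$ and $\Lambda_{k+1}=\Lambda_k\cup\{\mu\in\Lambda: p_{\mu j}=0\text{ for some }j\in I_k\}$. Let $\zeta(\lambda,i)$ be the least $k$ with $I_{k+1}=I_k$ and $\Lambda_{k+1}=\Lambda_k$. The $0$-closure $(\lambda,i)$-submatrix of $P$ is $P[\Lambda_k|I_k]$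 with $k=\zeta(\lambda,i)$. A $0$-closure submatrix of $P$ is a $0$-closure $(\lambda,i)$-submatrix for some $(\lambda,i)$ with $p_{\lambda i}=0$. Two $0$-closure submatrices $P[\Lambda_Q|I_Q]$, $P[\Lambda_M|I_M]$ either have the same index sets or satisfy $I_Q\cap I_M=\Lambda_Q\cap\Lambda_M=\emptyset$; they are called distinct in the latter case. If $Q=P[\Lambda_Q|I_Q]$ is a $0$-closure submatrix of $P$, the connected component determined by $Q$ is the connected component with vertex set $I_Q\times G\times\Lambda_Q$. If $Q=P[\Lambda_Q|I_Q]$ and $M=P[\Lambda_M|I_M]$ are distinct $0$-closure submatrices, the connected component determined by $Q$ and $M$ is the connected component with vertex set $(I_Q\times G\times\Lambda_M)\cup(I_M\times G\times\Lambda_Q)$. *)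

(* Defs.v *)
From mathcomp Require Import all_boot fingroup.

Set Implicit Arguments.
Unset Strict Implicit.
Unset Printing Implicit Defensive.

Local Open Scope group_scope.

Section SimpleGraph.

Variable T : finType.

Record sgraph := SGraph {
  vset : {set T};
  adj : rel T;
  adj_sym : symmetric adj;
  adj_irr : irreflexive adj;
  adj_vset : forall x y, adj x y -> x \in vset
}.

Definition walk_of_length (H : sgraph) (n : nat) (x y : T) : bool :=
  [exists p : n.-tuple T, path (adj H) x p && (last x p == y)].

(* Two vertices joined by a walk are at distance at most #|T| - 1, so [find]
   returns the least length of such a walk. Vertices in different connected
   components get the value #|T|, which is larger than any actual distance. *)
Definition dist (H : sgraph) (x y : T) : nat :=
  find (fun n => walk_of_length H n x y) (iota 0 #|T|).

Definition diam (H : sgraph) : nat :=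
  \max_(x in vset H) \max_(y in vset H) dist H x y.

Definition connected (H : sgraph) : Prop :=
  {in vset H &, forall x y, connect (adj H) x y}.

Definition is_component (H : sgraph) (A : {set T}) : Prop :=
  exists2 x, x \in vset H & A = [set y | connect (adj H) x y].

Section Induced.

Variables (H : sgraph) (A : {set T}).

Definition induced_adj : rel T := fun x y => [&& x \in A, y \in A & adj H x y].

Lemma induced_sym : symmetric induced_adj.
Proof. by move=> x y; rewrite /induced_adj adj_sym andbCA. Qed.

Lemma induced_irr : irreflexive induced_adj.
Proof. by move=> x; rewrite /induced_adj adj_irr !andbF. Qed.

Lemma induced_vset x y : induced_adj x y -> x \in vset H :&: A.
Proof. by case/and3P=> xA _ /adj_vset xV; rewrite inE xV. Qed.

Definition induced : sgraph := SGraph induced_sym induced_irr induced_vset.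

End Induced.

End SimpleGraph.

Section CommutingGraph.

(* MathComp's [semigroupType] has no join with [finType]. *)
Record finSemigroup := FinSemigroup {
  carrier :> finType;
  smul : carrier -> carrier -> carrier;
  smulA : associative smul
}.

Variable S : finSemigroup.

Definition center_of : {set S} :=
  [set x : S | [forall y : S, smul x y == smul y x]].

Definition comm_adj : rel S := fun x y =>
  [&& x \notin center_of, y \notin center_of, x != y & smul x y == smul y x].

Lemma comm_adj_sym : symmetric comm_adj.
Proof. by move=> x y; rewrite /comm_adj andbCA eq_sym [_ == smul _ _]eq_sym. Qed.

Lemma comm_adj_irr : irreflexive comm_adj.
Proof. by move=> x; rewrite /comm_adj eqxx !andbF. Qed.

Lemma comm_adj_vset x y : comm_adj x y -> x \in ~: center_of.
Proof. by case/and4P=> xZ *; rewrite inE. Qed.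

Definition comm_graph : sgraph S :=
  SGraph comm_adj_sym comm_adj_irr comm_adj_vset.

End CommutingGraph.

Section Rees.

(* G is the whole finite group [gT], and G^0 is [option gT] with zero [None].
   A Lambda x I matrix over G^0 is a function [L -> I -> option gT]. *)
Variables (gT : finGroupType) (I L : finType) (P : L -> I -> option gT).

Definition regular_matrix : Prop :=
  (forall l, exists i, P l i != None) /\ (forall i, exists l, P l i != None).

Definition rees0 : finType := option (I * gT * L).

Definition rees0_mul (a b : rees0) : rees0 :=
  if a is Some (i, x, l) then
    if b is Some (j, y, m) then
      if P l j is Some p then Some (i, x * p * y, m) else None
    else None
  else None.

Lemma rees0_mulA : associative rees0_mul.
Proof.
move=> [[[i x] l]|] [[[j y] m]|] [[[k z] n]|] //=.
- case Pmk: (P m k) => [q|]; case Plj: (P l j) => [p|] //=.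
    by rewrite ?Plj ?Pmk !mulgA.
  by rewrite ?Pmk.
- by case: (P l j).
Qed.

Definition rees0_semigroup : finSemigroup := FinSemigroup rees0_mulA.

Definition rees0_graph : sgraph rees0 := comm_graph rees0_semigroup.

(* The submatrix P[sub_rows | sub_cols], located by its index sets. *)
Record submatrix := Submatrix { sub_rows : {set L}; sub_cols : {set I} }.

Definition closure_step (B : submatrix) : submatrix :=
  Submatrix
    (sub_rows B :|: [set m | [exists j in sub_cols B, P m j == None]])
    (sub_cols B :|: [set j | [exists m in sub_rows B, P m j == None]]).

(* [closure_seq l i k] has index sets Lambda_k and I_k. *)
Definition closure_seq (l : L) (i : I) (k : nat) : submatrix :=
  iter k closure_step (Submatrix [set l] [set i]).

Definition closure_stable (l : L) (i : I) (k : nat) : bool :=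
  (sub_cols (closure_seq l i k.+1) == sub_cols (closure_seq l i k)) &&
  (sub_rows (closure_seq l i k.+1) == sub_rows (closure_seq l i k)).

Lemma closure_stable_ex l i : exists k, closure_stable l i k.
Proof.
pose w k := (#|sub_cols (closure_seq l i k)| + #|sub_rows (closure_seq l i k)|)%N.
have [/existsP[k kP]|/existsPn H] :=
  boolP [exists k : 'I_(#|I| + #|L|).+1, closure_stable l i k]; first by exists k.
have wlt k : (k < (#|I| + #|L|).+1)%N -> (k < w k.+1)%N.
  elim: k => [|k IHk] lt_k.
    rewrite /w addn_gt0; apply/orP; left; apply/card_gt0P; exists i.
    by rewrite !inE eqxx.
  apply: leq_ltn_trans (IHk (ltnW lt_k)) _.
  have := H (Ordinal lt_k); rewrite /closure_stable negb_and [nat_of_ord _]/=.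
  change (closure_seq l i k.+2) with (closure_step (closure_seq l i k.+1)).
  rewrite /w; set B := closure_seq l i k.+1 => neq.
  have sC : sub_cols B \subset sub_cols (closure_step B) by apply: subsetUl.
  have sR : sub_rows B \subset sub_rows (closure_step B) by apply: subsetUl.
  case/orP: neq => neq.
    rewrite -addSn leq_add ?(subset_leq_card sR) //.
    by rewrite proper_card // properEneq eq_sym neq.
  rewrite -addnS leq_add ?(subset_leq_card sC) //.
  by rewrite proper_card // properEneq eq_sym neq.
have := wlt _ (ltnSn _); rewrite ltnNge leq_add ?max_card //.
Qed.

Definition zeta (l : L) (i : I) : nat := ex_minn (closure_stable_ex l i).

Definition closure_submatrix (l : L) (i : I) : submatrix :=
  closure_seq l i (zeta l i).

Definition is_closure_submatrix (Q : submatrix) : Prop :=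
  exists l i, P l i = None /\ Q = closure_submatrix l i.

Definition distinct_submatrices (Q M : submatrix) : Prop :=
  [disjoint sub_cols Q & sub_cols M] /\ [disjoint sub_rows Q & sub_rows M].

(* The set A x G x B of nonzero elements. *)
Definition block (A : {set I}) (B : {set L}) : {set rees0} :=
  [set s : rees0 | if s is Some (i, _, l) then (i \in A) && (l \in B) else false].

Definition verts1 (Q : submatrix) : {set rees0} :=
  block (sub_cols Q) (sub_rows Q).

Definition verts2 (Q M : submatrix) : {set rees0} :=
  block (sub_cols Q) (sub_rows M) :|: block (sub_cols M) (sub_rows Q).

Definition component1 (Q : submatrix) : sgraph rees0 :=
  induced rees0_graph (verts1 Q).

Definition component2 (Q M : submatrix) : sgraph rees0 :=
  induced rees0_graph (verts2 Q M).

(* The rest of the section checks that the vertex sets above are indeed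
   connected components of the commuting graph. *)

Lemma closure_submatrix_closed Q l j :
  is_closure_submatrix Q -> P l j = None ->
  (l \in sub_rows Q) = (j \in sub_cols Q).
Proof.
case=> l0 [i0 [_ ->]] Plj; rewrite /closure_submatrix /zeta.
case: ex_minnP => k /andP[/eqP eC /eqP eR] _.
apply/idP/idP => h.
  by rewrite -eC !inE; apply/orP; right; apply/existsP; exists l; rewrite h Plj.
by rewrite -eR !inE; apply/orP; right; apply/existsP; exists j; rewrite h Plj.
Qed.

(* Two columns (rows) are linked when they have a zero in a common row
   (column). *)
Let col_link : rel I := fun i i' => [exists l, (P l i == None) && (P l i' == None)].
Let row_link : rel L := fun l l' => [exists i, (P l i == None) && (P l' i == None)].

Let row_col l l' j j' : connect row_link l l' ->
  P l j = None -> P l' j' = None -> connect col_link j j'.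
Proof.
case/connectP=> p + ->; elim: p l j => [|m p IHp] l j /=.
  by move=> _ h h'; apply/connect1/existsP; exists l; rewrite h h'.
case/andP=> /existsP[i /andP[/eqP Pli /eqP Pmi]] pP Plj Pj'.
apply: (connect_trans (y := i)); last exact: IHp pP Pmi Pj'.
by apply/connect1/existsP; exists l; rewrite Pli Plj.
Qed.

Let col_row i i' m m' : connect col_link i i' ->
  P m i = None -> P m' i' = None -> connect row_link m m'.
Proof.
case/connectP=> p + ->; elim: p i m => [|j p IHp] i m /=.
  by move=> _ h h'; apply/connect1/existsP; exists i; rewrite h h'.
case/andP=> /existsP[l /andP[/eqP Pli /eqP Plj]] pP Pmi Pm'.
apply: (connect_trans (y := l)); last exact: IHp pP Plj Pm'.
by apply/connect1/existsP; exists i; rewrite Pli Pmi.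
Qed.

Let closure_link l0 i0 k : P l0 i0 = None ->
  {in sub_cols (closure_seq l0 i0 k), forall i, connect col_link i i0} /\
  {in sub_rows (closure_seq l0 i0 k), forall l, connect row_link l l0}.
Proof.
move=> P0; elim: k => [|k [IHc IHr]] /=.
  by split=> x; rewrite inE => /eqP->; apply: connect0.
split=> x; rewrite !inE => /orP[|/existsP[y /andP[yin /eqP Pxy]]].
- exact: IHc.
- exact: row_col (IHr _ yin) Pxy P0.
- exact: IHr.
- exact: col_row (IHc _ yin) Pxy P0.
Qed.

Let vertexP (i : I) (x : gT) (l : L) : regular_matrix -> (exists l i, P l i = None) ->
  (Some (i, x, l) : rees0) \in vset rees0_graph.
Proof.
move=> [regr regc] [l1 [i1 P1]].
have [j Plj] := regr l.
have [m ml] : exists m, m != l.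
  case: (eqVneq l1 l) => [e|]; last by exists l1.
  have [m Pm] := regc i1; exists m; apply: contraNneq Pm => ->.
  by rewrite -e P1.
rewrite !inE; apply/forallPn; exists (Some (j, 1, m)) => /=.
case: (P l j) Plj => // p _; case: (P m i) => // q.
by apply/eqP; case=> _ _ /eqP; rewrite (negPf ml).
Qed.

Let zero_step i x l j y m : regular_matrix -> P l j = None -> P m i = None ->
  connect (adj rees0_graph) (Some (i, x, l)) (Some (j, y, m)).
Proof.
move=> reg Plj Pmi.
have ex0 : exists l i, P l i = None by exists l, j.
case: (eqVneq (Some (i, x, l) : rees0) (Some (j, y, m))) => [->|ne].
  exact: connect0.
apply: connect1; rewrite /= /comm_adj.
have := vertexP i x l reg ex0; have := vertexP j y m reg ex0.
rewrite !in_setC => -> -> /=; rewrite Plj Pmi eqxx andbT.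
exact: ne.
Qed.

Lemma verts2_component Q M :
  regular_matrix -> is_closure_submatrix Q -> is_closure_submatrix M ->
  is_component rees0_graph (verts2 Q M).
Proof.
move=> reg clQ clM.
have [lQ [iQ [PQ eQ]]] := clQ; have [lM [iM [PM eM]]] := clM.
have ex0 : exists l i, P l i = None by exists lQ, iQ.
have [cQ rQ] := closure_link (zeta lQ iQ) PQ.
have [cM rM] := closure_link (zeta lM iM) PM.
rewrite -/(closure_submatrix _ _) -eQ in cQ rQ.
rewrite -/(closure_submatrix _ _) -eM in cM rM.
pose c a b := connect (adj rees0_graph) a b.
have cS : connect_sym (adj rees0_graph) by apply/sym_connect_sym/adj_sym.
have colwalk l j i i' x : P l j = None -> connect col_link i i' ->
    c (Some (i, x, l)) (Some (i', x, l)).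
  move=> Plj /connectP[p + ->]; elim: p i => [|k p IHp] i /=.
    by move=> _; apply: connect0.
  case/andP=> /existsP[m /andP[/eqP Pmi /eqP Pmk]] /IHp.
  apply: connect_trans; apply: (connect_trans (y := Some (j, 1, m))).
    exact: zero_step.
  exact: zero_step.
have rowwalk m i l l' x : P m i = None -> connect row_link l l' ->
    c (Some (i, x, l)) (Some (i, x, l')).
  move=> Pmi /connectP[p + ->]; elim: p l => [|k p IHp] l /=.
    by move=> _; apply: connect0.
  case/andP=> /existsP[j /andP[/eqP Plj /eqP Pkj]] /IHp.
  apply: connect_trans; apply: (connect_trans (y := Some (j, 1, m))).
    exact: zero_step.
  exact: zero_step.
have toQM i x l : i \in sub_cols Q -> l \in sub_rows M ->
    c (Some (i, x, l)) (Some (iM, 1, lQ)).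
  move=> /cQ ci /rM rl.
  have [m Pmi] : exists m, P m i = None.
    move: ci; rewrite (sym_connect_sym _); last first.
      by move=> u v; rewrite /col_link; under eq_existsb do rewrite andbC.
    case/connectP; case/lastP=> [|p k] /=; first by move=> _ ->; exists lQ.
    rewrite rcons_path last_rcons => /andP[_ /existsP[m /andP[_ /eqP h]]] ->.
    by exists m.
  apply: (connect_trans (y := Some (i, x, lM))).
    exact: (rowwalk m).
  apply: (connect_trans (y := Some (iQ, x, lM))).
    exact: (colwalk lM iM).
  exact: zero_step.
have toMQ i x l : i \in sub_cols M -> l \in sub_rows Q ->
    c (Some (i, x, l)) (Some (iM, 1, lQ)).
  move=> /cM ci /rQ rl.
  have [m Pmi] : exists m, P m i = None.
    move: ci; rewrite (sym_connect_sym _); last first.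
      by move=> u v; rewrite /col_link; under eq_existsb do rewrite andbC.
    case/connectP; case/lastP=> [|p k] /=; first by move=> _ ->; exists lM.
    rewrite rcons_path last_rcons => /andP[_ /existsP[m /andP[_ /eqP h]]] ->.
    by exists m.
  apply: (connect_trans (y := Some (i, x, lQ))).
    exact: (rowwalk m).
  apply: (connect_trans (y := Some (iM, x, lQ))).
    exact: (colwalk lQ iQ).
  apply: (connect_trans (y := Some (iQ, 1, lM))); exact: zero_step.
have iMin : iM \in sub_cols M.
  rewrite eM /closure_submatrix; elim: (zeta _ _) => [|k IHk].
    by rewrite inE.
  by rewrite inE IHk.
have lQin : lQ \in sub_rows Q.
  by rewrite (closure_submatrix_closed clQ PQ) eQ /closure_submatrix;
    elim: (zeta _ _) => [|k IHk]; rewrite inE ?IHk.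
exists (Some (iM, 1, lQ)); first exact: vertexP.
apply/setP=> s; rewrite [in RHS]inE; apply/idP/idP.
  rewrite cS; case: s => [[[i x] l]|]; last by rewrite !inE.
  by rewrite !inE => /orP[]/andP[*]; [apply: toQM | apply: toMQ].
case/connectP=> p + ->.
have : (Some (iM, 1, lQ) : rees0) \in verts2 Q M.
  by rewrite !inE iMin lQin orbT.
elim: p (Some (iM, 1, lQ) : rees0) => [|b p IHp] a //= aV.
case/andP=> adj_ab /(IHp b); apply; move: (adj_ab).
rewrite comm_adj_sym => /comm_adj_vset; case/and4P: adj_ab => _ _ _ + bZ.
case: b bZ => [[[j y] m]|] bZ; last first.
  move: bZ; rewrite !inE => /forallP[] /= [[[? ?] ?]|] //.
case: a aV => [[[i x] l]|]; last by rewrite !inE.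
rewrite /= !inE; case Plj: (P l j) => [p1|]; case Pmi: (P m i) => [p2|] //.
  by move=> h /eqP[<- _ ->].
move=> h _; move: h.
by rewrite !(closure_submatrix_closed clQ Plj, closure_submatrix_closed clM Plj,
  closure_submatrix_closed clQ Pmi, closure_submatrix_closed clM Pmi) orbC
  ![_ && (_ \in sub_cols Q)]andbC.
Qed.

Lemma verts1_component Q : regular_matrix -> is_closure_submatrix Q ->
  is_component rees0_graph (verts1 Q).
Proof. by move=> reg clQ; have := verts2_component reg clQ clQ; rewrite /verts2 setUid. Qed.

End Rees.

(* Main.v *)
Require Import Defs.
From mathcomp Require Import all_boot fingroup zify.

(* Let Z be the bipartite graph on columns and rows whose edges are the zeros of
   P, and let D_Q be the diameter of the component of Z determined by Q. A walk
   in the commuting graph is, up to steps that change only the group coordinate,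
   a pair of simultaneous walks in Z, and in a bipartite graph the lengths of the
   walks between two given vertices have a fixed parity. In C_QM the sides of the
   end points determine the parity of the walk, whence diam C_QM = max(D_Q, D_M)
   unless this is smaller than the diameter 2 caused by non-commuting elements
   (i,x,l), (i,y,l). In C_Q both parities are available, the better one saves a
   step, and diam C_Q = D_Q - 1 as soon as D_Q >= 2. Finally D_Q = 1 exactly when
   Q is a 1 x 1 submatrix. *)

Set Implicit Arguments.
Unset Strict Implicit.
Unset Printing Implicit Defensive.

(** A bound of the wrong parity is never attained, which saves one step. *)
Lemma leq_pred_parity n k : n <= k -> odd n = ~~ odd k -> n <= k.-1.
Proof. by rewrite leq_eqVlt => /orP[/eqP->|]; lia. Qed.

(** * Walks, distances and diameters of components in a finite simple graph *)

Section GraphDistance.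

Variables (T : finType) (H : sgraph T).
Implicit Types (x y z : T) (A : {set T}).

Lemma walkP n x y :
  reflect (exists p, [/\ size p = n, path (adj H) x p & last x p = y])
          (walk_of_length H n x y).
Proof.
apply: (iffP existsP) => [[p /andP[pp /eqP e]]|[p [sp pp e]]].
  by exists p; rewrite size_tuple.
by move/eqP: sp => sp; exists (Tuple sp); rewrite /= pp e eqxx.
Qed.

Lemma walk0 x y : walk_of_length H 0 x y = (x == y).
Proof.
apply/walkP/eqP => [[[|? ?] [] //]|->]; by exists [::].
Qed.

Lemma walkS n x y :
  walk_of_length H n.+1 x y =
  [exists z, adj H x z && walk_of_length H n z y].
Proof.
apply/walkP/existsP => [[[|z p] [] //= [sp] /andP[xz pp] e]|].
  by exists z; rewrite xz; apply/walkP; exists p.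
case=> z /andP[xz /walkP[p [sp pp e]]].
by exists (z :: p); rewrite /= sp xz pp e.
Qed.

Lemma walk1 x y : walk_of_length H 1 x y = adj H x y.
Proof.
rewrite walkS; apply/existsP/idP => [[z]|xy].
  by rewrite walk0 => /andP[xz /eqP <-].
by exists y; rewrite xy walk0 eqxx.
Qed.

(** Going to [z] and back before starting the walk adds 2 to its length. *)
Lemma walk_pad n k x y z : adj H x z -> n <= k -> odd n = odd k ->
  walk_of_length H n x y -> walk_of_length H k x y.
Proof.
move=> xz le_nk par w.
have -> : k = n + (k - n)./2.*2 by lia.
elim: (k - n)./2 => [|h IHh]; first by rewrite addn0.
rewrite doubleS !addnS walkS; apply/existsP; exists z; rewrite xz walkS.
by apply/existsP; exists x; rewrite adj_sym xz.
Qed.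

Lemma dist_le_walk n x y : walk_of_length H n x y -> dist H x y <= n.
Proof.
move=> w; case: (ltnP n #|T|) => [lt|ge].
  rewrite leqNgt; apply/negP => /(before_find 0).
  by rewrite nth_iota // w.
by apply: leq_trans ge; rewrite -[X in _ <= X](size_iota 0) find_size.
Qed.

Lemma walk_dist_lt x y : dist H x y < #|T| -> walk_of_length H (dist H x y) x y.
Proof.
move=> lt.
have := lt; rewrite -[X in _ < X](size_iota 0) -has_find => /(nth_find 0).
by rewrite nth_iota.
Qed.

Lemma walk_dist x y : connect (adj H) x y -> walk_of_length H (dist H x y) x y.
Proof.
(* A path without repeated vertices has fewer than [#|T|] edges, so the search in [dist]
   succeeds. *)
case/connectP=> p pp ->; case/shortenP: pp => q pq uq _.
apply: walk_dist_lt; apply: (@leq_ltn_trans (size q)).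
  by apply/dist_le_walk/walkP; exists q.
by have := max_card (mem (x :: q)); rewrite (card_uniqP uq).
Qed.

Lemma walk_sym n x y : walk_of_length H n x y = walk_of_length H n y x.
Proof.
suff sub a b : walk_of_length H n a b -> walk_of_length H n b a.
  by apply/idP/idP; apply: sub.
case/walkP=> p [sp pp <-]; apply/walkP; exists (rev (belast a p)).
rewrite size_rev size_belast rev_path; split=> //.
  by rewrite (eq_path (e' := adj H)) // => s t; apply: adj_sym.
by case: p {sp pp} => //= c p; rewrite rev_cons last_rcons.
Qed.

Lemma dist_sym x y : dist H x y = dist H y x.
Proof. by apply: eq_find => n; apply: walk_sym. Qed.

Lemma dist_adj x y : adj H x y -> dist H x y <= 1.
Proof. by rewrite -walk1 => /dist_le_walk. Qed.

Lemma distxx x : dist H x x = 0.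
Proof. by apply/eqP; rewrite -leqn0 dist_le_walk // walk0. Qed.

Lemma dist_step x y z : adj H x y -> dist H x z <= (dist H y z).+1.
Proof.
move=> xy; case: (ltnP (dist H y z) #|T|) => [/walk_dist_lt w|ge].
  by apply: dist_le_walk; rewrite walkS; apply/existsP; exists y; rewrite xy.
(* Now [dist H y z] is the default value [#|T|], which no value of [dist] exceeds. *)
apply: leqW; apply: leq_trans ge.
by rewrite -[X in _ <= X](size_iota 0) find_size.
Qed.

Lemma connect_walk n x y : walk_of_length H n x y -> connect (adj H) x y.
Proof. by case/walkP=> p [_ pp <-]; apply/connectP; exists p. Qed.

Section Component.

Variables (A : {set T}) (A_comp : is_component H A).

Lemma component_connect : {in A &, forall x y, connect (adj H) x y}.
Proof.
case: A_comp => a _ -> x y; rewrite !inE => ax; apply: connect_trans.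
by rewrite (sym_connect_sym (@adj_sym _ H)).
Qed.

Lemma component_closed x y : x \in A -> connect (adj H) x y -> y \in A.
Proof. by case: A_comp => a _ ->; rewrite !inE; apply: connect_trans. Qed.

Lemma component_vset : A \subset vset H.
Proof.
case: A_comp => a aV ->; apply/subsetP => y.
rewrite inE (sym_connect_sym (@adj_sym _ H)) => /connectP[[|z p] /=].
  by move=> _ <-.
by case/andP=> /adj_vset.
Qed.

Lemma vset_induced_component : vset (induced H A) = A.
Proof. exact/setIidPr/component_vset. Qed.

(** A walk that starts in a component never leaves it. *)
Lemma walk_induced n x y : x \in A ->
  walk_of_length (induced H A) n x y = walk_of_length H n x y.
Proof.
move=> xA; rewrite /walk_of_length; apply: eq_existsb => p; congr andb.
case: p => p _ /=; elim: p x xA => [|z p' IHp] x xA //=.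
rewrite {1}/induced_adj xA /=; case xz: (adj H x z); last by rewrite andbF.
have zA : z \in A by apply: component_closed xA (connect1 xz).
by rewrite zA IHp.
Qed.

Lemma dist_induced x y : x \in A -> dist (induced H A) x y = dist H x y.
Proof. by move=> xA; apply: eq_find => n; apply: walk_induced. Qed.

Lemma diam_component_leP n :
  reflect {in A &, forall x y, dist H x y <= n} (diam (induced H A) <= n).
Proof.
rewrite /diam vset_induced_component.
apply: (iffP (bigmax_leqP _ _ _)) => [le x y xA yA|le x xA].
  by have /bigmax_leqP/(_ y yA) := le x xA; rewrite dist_induced.
by apply/bigmax_leqP => y yA; rewrite dist_induced // le.
Qed.

Lemma dist_le_diam x y : x \in A -> y \in A -> dist H x y <= diam (induced H A).
Proof. exact: (diam_component_leP _ (leqnn _)). Qed.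

Lemma diam_attained : exists x y,
  [/\ x \in A, y \in A & dist H x y = diam (induced H A)].
Proof.
have A0 : 0 < #|A|.
  by apply/card_gt0P; case: A_comp => a _ ->; exists a; rewrite inE connect0.
rewrite /diam vset_induced_component.
have [x xA ->] := eq_bigmax_cond
  (fun x => \max_(y in A) dist (induced H A) x y) A0.
have [y yA ->] := eq_bigmax_cond (dist (induced H A) x) A0.
by exists x, y; rewrite dist_induced.
Qed.

End Component.

End GraphDistance.

(** * The bipartite graph of zeros of [P] and its components *)

Section ZeroGraph.

Variables (gT : finGroupType) (I L : finType) (P : L -> I -> option gT).

Definition zero_adj : rel (I + L) := fun u v =>
  match u, v with
  | inl i, inr l | inr l, inl i => P l i == None
  | _, _ => false
  end.

Lemma zero_adj_sym : symmetric zero_adj.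
Proof. by case=> [i|l] [j|m]. Qed.

Lemma zero_adj_irr : irreflexive zero_adj.
Proof. by case. Qed.

Lemma zero_adj_vset u v : zero_adj u v -> u \in [set: I + L].
Proof. by rewrite inE. Qed.

(* The components of this graph with an edge are the 0-closure submatrices. *)
Definition zero_graph : sgraph (I + L)%type :=
  SGraph zero_adj_sym zero_adj_irr zero_adj_vset.

Definition is_row (u : I + L) : bool := if u is inr _ then true else false.

Definition sides (Q : submatrix I L) : {set I + L} :=
  [set u | match u with inl i => i \in sub_cols Q | inr l => l \in sub_rows Q end].

Lemma in_sides_col Q i : (inl i \in sides Q) = (i \in sub_cols Q).
Proof. by rewrite inE. Qed.

Lemma in_sides_row Q l : (inr l \in sides Q) = (l \in sub_rows Q).
Proof. by rewrite inE. Qed.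

(** Every edge joins a column to a row, so each step changes sides. *)
Lemma zero_walk_parity n u v :
  walk_of_length zero_graph n u v -> odd n = is_row u (+) is_row v.
Proof.
elim: n u => [|n IHn] u; first by rewrite walk0 => /eqP->; rewrite addbb.
rewrite walkS => /existsP[w /andP[uw /IHn /= ->]].
by case: u w uw => [i|l] [j|m] //= _; case: (is_row v).
Qed.

(** Each index added by a closure step shares a zero with an index already present. *)
Lemma closure_seq_connect l i k : P l i = None ->
  {in sides (closure_seq P l i k), forall u, connect zero_adj (inl i) u}.
Proof.
move=> P0; elim: k => [|k IHk] u.
  rewrite inE; case: u => [j|m] /=; rewrite inE => /eqP->; first exact: connect0.
  by apply: connect1; rewrite /= P0.
rewrite inE; case: u => [j|m] /=; rewrite !inE => /orP[h|/existsP[v /andP[h z]]].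
- by apply: IHk; rewrite inE.
- apply: connect_trans (connect1 (_ : zero_adj (inr v) (inl j))) => //.
  by apply: IHk; rewrite inE.
- by apply: IHk; rewrite inE.
- apply: connect_trans (connect1 (_ : zero_adj (inl v) (inr m))) => //.
  by apply: IHk; rewrite inE.
Qed.

Variables (Q : submatrix I L) (Q_closure : is_closure_submatrix P Q).

Lemma zero_adj_sides u v : zero_adj u v -> (u \in sides Q) = (v \in sides Q).
Proof.
by case: u v => [i|l] [j|m] //= /eqP/(closure_submatrix_closed Q_closure) e;
  rewrite !inE e.
Qed.

Lemma closure_zero_entry : exists l i,
  [/\ P l i = None, l \in sub_rows Q & i \in sub_cols Q].
Proof.
case: (Q_closure) => l [i [P0 e]]; exists l, i.
have iQ : i \in sub_cols Q.
  rewrite e /closure_submatrix; elim: (zeta _ _ _) => [|k IHk].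
    by rewrite inE.
  by rewrite inE IHk.
by rewrite (closure_submatrix_closed Q_closure P0).
Qed.

Lemma sides_component : is_component zero_graph (sides Q).
Proof.
case: (Q_closure) => l [i [P0 e]]; exists (inl i); first by rewrite inE.
apply/setP => u; rewrite [in RHS]inE; apply/idP/idP => [|/connectP[p]].
  by rewrite e; apply: closure_seq_connect.
have iQ : inl i \in sides Q.
  rewrite inE e /closure_submatrix; elim: (zeta _ _ _) => [|k IHk].
    by rewrite inE.
  by rewrite inE IHk.
elim: p (inl i : I + L) iQ => [|v p IHp] w wQ /=; first by move=> _ ->.
by case/andP=> /zero_adj_sides wv; apply: IHp; rewrite -wv.
Qed.

(** Take the first step of a path to the column [i] of a zero entry; if [u] is that column, take the
    row of the entry. *)
Lemma zero_neighbour u : u \in sides Q -> exists2 v, v \in sides Q & zero_adj u v.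
Proof.
move=> uQ; have [l [i [P0 lQ iQ]]] := closure_zero_entry.
suff [v uv] : exists v, zero_adj u v by exists v; rewrite -?(zero_adj_sides uv).
have iQ' : inl i \in sides Q by rewrite inE.
have /connectP[[|v p] /=] := component_connect sides_component uQ iQ'.
  by move=> _ <-; exists (inr l); rewrite /= P0.
by case/andP=> uv _ _; exists v.
Qed.

(** Distance and parity are the only obstructions to a walk of given length: a shortest walk is
    padded along an edge at [u]. *)
Lemma zero_walkE n u v : u \in sides Q -> v \in sides Q ->
  walk_of_length zero_graph n u v =
  (dist zero_graph u v <= n) && (odd n == is_row u (+) is_row v).
Proof.
move=> uQ vQ; apply/idP/andP => [w|[le /eqP par]].
  by rewrite (dist_le_walk w) (zero_walk_parity w).
have w := walk_dist (component_connect sides_component uQ vQ).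
have [z _ uz] := zero_neighbour uQ.
by apply: (walk_pad (H := zero_graph) uz le _ w); rewrite par (zero_walk_parity w).
Qed.

Lemma odd_zero_dist u v : u \in sides Q -> v \in sides Q ->
  odd (dist zero_graph u v) = is_row u (+) is_row v.
Proof.
move=> uQ vQ; apply/zero_walk_parity/walk_dist.
exact: (component_connect sides_component).
Qed.

Lemma zero_dist_adj u v : u \in sides Q -> v \in sides Q ->
  (dist zero_graph u v == 1) = zero_adj u v.
Proof.
move=> uQ vQ; apply/eqP/idP => [d1|uv].
  rewrite -[zero_adj u v]/(adj zero_graph u v) -walk1 -{1}d1.
  exact/walk_dist/(component_connect sides_component).
apply/eqP; rewrite eqn_leq (dist_adj (H := zero_graph) uv) lt0n; apply/negP => /eqP d0.
have := odd_zero_dist uQ vQ.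
by rewrite d0; case: u v uv {d0 uQ vQ} => [?|?] [?|?].
Qed.

Lemma zero_dist_eq0 u v : u \in sides Q -> v \in sides Q ->
  (dist zero_graph u v == 0) = (u == v).
Proof.
move=> uQ vQ; rewrite -(walk0 zero_graph) zero_walkE // leqn0.
case: eqP => //= d0; apply/esym/eqP.
by rewrite -odd_zero_dist // d0.
Qed.

End ZeroGraph.

(* A zero product (i,x,l)(j,y,m) = 0 = (j,y,m)(i,x,l) moves the column [i] to the
   row [m] and the row [l] to the column [j] along zeros of [P], so a walk in
   the commuting graph is a pair of simultaneous walks in the zero graph. *)
Section PairWalks.

Variables (gT : finGroupType) (I L : finType) (P : L -> I -> option gT).

Local Notation walk := (walk_of_length (zero_graph P)).

(** After an odd number of steps the two walkers have exchanged sides, so the one from the column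
    [i] ends at the row [m]. *)
Definition pair_walk n (i : I) (l : L) (j : I) (m : L) : bool :=
  if odd n then walk n (inl i) (inr m) && walk n (inr l) (inl j)
  else walk n (inl i) (inl j) && walk n (inr l) (inr m).

Lemma pair_walk0 i l : pair_walk 0 i l i l.
Proof. by rewrite /pair_walk /= !walk0 !eqxx. Qed.

Lemma pair_walkS n i l j m :
  reflect (exists i' l', [/\ P l i' = None, P l' i = None & pair_walk n i' l' j m])
          (pair_walk n.+1 i l j m).
Proof.
rewrite /pair_walk /=; case: (odd n); rewrite /= !walkS.
  apply: (iffP andP) => [[/existsP[[//|l']] + /existsP[[i'|//]]]|].
    move=> /andP[/eqP zi w] /andP[/eqP zl w']; exists i', l'.
    by rewrite w w'.
  case=> i' [l' [zl zi /andP[w w']]]; split; apply/existsP.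
    by exists (inr l'); rewrite /= zi w'.
  by exists (inl i'); rewrite /= zl w.
apply: (iffP andP) => [[/existsP[[//|l']] + /existsP[[i'|//]]]|].
  move=> /andP[/eqP zi w] /andP[/eqP zl w']; exists i', l'.
  by rewrite w w'.
case=> i' [l' [zl zi /andP[w w']]]; split; apply/existsP.
  by exists (inr l'); rewrite /= zi w'.
by exists (inl i'); rewrite /= zl w.
Qed.

Hypotheses (P_regular : regular_matrix P) (P_zero : exists l i, P l i = None).

Local Notation H := (rees0_graph P).

Lemma rees_zero_notin_vset : (None : rees0 gT I L) \notin vset H.
Proof. by rewrite /= in_setC negbK inE; apply/forallP => -[[[? ?] ?]|]. Qed.

(** With [P l j] nonzero and [m != l], the element [(j, 1, m)] does not commute with [(i, x, l)]:
    one product is nonzero with row [m], the other is zero or has row [l]. If the known zero lies in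
    row [l], regularity of its column yields another row. *)
Lemma rees_nonzero_vset i x l : (Some (i, x, l) : rees0 gT I L) \in vset H.
Proof.
have [l1 [i1 P1]] := P_zero.
have [j Plj] := P_regular.1 l.
have [m ml] : exists m, m != l.
  have [e|?] := eqVneq l1 l; last by exists l1.
  have [m Pm] := P_regular.2 i1; exists m; apply: contraNneq Pm => ->.
  by rewrite -e P1.
rewrite !inE; apply/forallPn; exists (Some (j, 1%g, m)) => /=.
case: (P l j) Plj => // p _; case: (P m i) => // q.
by apply/eqP; case=> _ _ /eqP; rewrite (negPf ml).
Qed.

Lemma rees_adjE i x l j y m :
  adj H (Some (i, x, l)) (Some (j, y, m)) =
  ((Some (i, x, l) : rees0 gT I L) != Some (j, y, m)) &&
  (rees0_mul P (Some (i, x, l)) (Some (j, y, m))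
   == rees0_mul P (Some (j, y, m)) (Some (i, x, l))).
Proof.
have := rees_nonzero_vset i x l; have := rees_nonzero_vset j y m.
by rewrite /= /comm_adj !in_setC => -> ->.
Qed.

Lemma rees_zero_dist i x l j y m : P l j = None -> P m i = None ->
  dist H (Some (i, x, l)) (Some (j, y, m)) <= 1.
Proof.
move=> z z'.
have [->|ne] := eqVneq (Some (i, x, l) : rees0 gT I L) (Some (j, y, m)).
  by rewrite distxx.
by apply: dist_adj; rewrite rees_adjE ne /= z z'.
Qed.

(** Intermediate vertices get group coordinate 1, and the last step may change it to [y]. The length
    must be positive, since a pair walk of length 0 says nothing about [x] and [y]. *)
Lemma dist_pair_walk n i x l j y m : pair_walk n.+1 i l j m ->
  dist H (Some (i, x, l)) (Some (j, y, m)) <= n.+1.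
Proof.
elim: n i x l => [|n IHn] i x l /pair_walkS[i' [l' [z z']]].
  rewrite /pair_walk /= !walk0 => /andP[/eqP[ej] /eqP[em]].
  by apply: rees_zero_dist; rewrite -?ej -?em.
(* A vertex is not adjacent to itself, so a stationary step is dropped. *)
have [[-> _ ->] w|ne /(IHn _ 1%g _)] :=
    eqVneq (Some (i, x, l) : rees0 gT I L) (Some (i', 1%g, l')).
  exact: leqW (IHn _ _ _ w).
have a : adj H (Some (i, x, l)) (Some (i', 1%g, l')).
  by rewrite rees_adjE ne /= z z'.
move=> le; exact: leq_trans (dist_step _ a) _.
Qed.

(** Commuting elements with nonzero products have the same column and row. Such a step leaves the
    pair in place, hence [k <= n] rather than equality. *)
Lemma pair_walk_of_walk n i x l j y m :
  walk_of_length H n (Some (i, x, l)) (Some (j, y, m)) ->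
  exists2 k, k <= n & pair_walk k i l j m.
Proof.
elim: n i x l => [|n IHn] i x l.
  by rewrite walk0 => /eqP[-> _ ->]; exists 0; rewrite ?pair_walk0.
rewrite walkS => /existsP[[[[i' x'] l']|] /andP[a w]]; last first.
  by move: a; rewrite adj_sym => /adj_vset; rewrite (negPf rees_zero_notin_vset).
have [k le_k pw] := IHn _ _ _ w.
move: a; rewrite rees_adjE /= => /andP[_].
case z: (P l i') => [p|]; case z': (P l' i) => [q|] //.
  by move=> /eqP[ei _ el]; exists k; [apply: leqW | rewrite ei -el].
by move=> _; exists k.+1 => //; apply/pair_walkS; exists i', l'.
Qed.

End PairWalks.

(** * Diameters in the commuting graph in terms of [zero_diam], the [D_Q] of the overview *)

Section Diameters.

Variables (gT : finGroupType) (I L : finType) (P : L -> I -> option gT).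
Hypotheses (P_regular : regular_matrix P) (P_zero : exists l i, P l i = None).

Local Notation H := (rees0_graph P).
Local Notation Z := (zero_graph P).

Definition zero_diam (Q : submatrix I L) : nat := diam (induced Z (sides Q)).

Lemma rees_dist_ge n i x l j y m (A : {set rees0 gT I L}) :
  is_component H A ->
  (Some (i, x, l) : rees0 gT I L) \in A ->
  (Some (j, y, m) : rees0 gT I L) \in A ->
  (forall k, pair_walk P k i l j m -> n <= k) -> n <= diam (induced H A).
Proof.
move=> A_comp aA bA ge.
apply: leq_trans (dist_le_diam A_comp aA bA).
have := walk_dist (component_connect A_comp aA bA).
case/(pair_walk_of_walk P_regular P_zero) => k le_k /ge le_n.
exact: leq_trans le_n le_k.
Qed.

(** * The component determined by a single submatrix *)

Section OneSubmatrix.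

Variables (Q : submatrix I L) (Q_closure : is_closure_submatrix P Q).

Let Q_comp := sides_component Q_closure.

Lemma zero_dist_le u v : u \in sides Q -> v \in sides Q ->
  dist Z u v <= zero_diam Q.
Proof. exact: dist_le_diam. Qed.

Lemma zero_diam_gt0 : 0 < zero_diam Q.
Proof.
have [l [i [P0 lQ iQ]]] := closure_zero_entry Q_closure.
have iQ' : inl i \in sides Q by rewrite inE.
have lQ' : inr l \in sides Q by rewrite inE.
have il : dist Z (inl i) (inr l) == 1.
  by rewrite (zero_dist_adj Q_closure) //= P0.
by rewrite -(eqP il) zero_dist_le.
Qed.

(** Vertices on the same side have even distance; if it is at most 1, they coincide. *)
Lemma zero_diam_le1P :
  reflect (#|sub_cols Q| = 1 /\ #|sub_rows Q| = 1) (zero_diam Q <= 1).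
Proof.
apply/(equivP idP); have [l [i [P0 lQ iQ]]] := closure_zero_entry Q_closure.
split=> [le1|[/eqP/cards1P[i' eI] /eqP/cards1P[l' eL]]].
  have same u v : u \in sides Q -> v \in sides Q -> is_row u = is_row v -> u = v.
    move=> uQ vQ e; apply/eqP; rewrite -(zero_dist_eq0 Q_closure) //.
    have := odd_zero_dist Q_closure uQ vQ; rewrite e addbb.
    by have := zero_dist_le uQ vQ; lia.
  split; apply/eqP/cards1P; [exists i | exists l]; apply/setP=> t; rewrite inE.
    apply/idP/eqP => [tQ|-> //].
    by have := same (inl t) (inl i); rewrite !inE => /(_ tQ iQ erefl)[].
  apply/idP/eqP => [tQ|-> //].
  by have := same (inr t) (inr l); rewrite !inE => /(_ tQ lQ erefl)[].
move: iQ lQ; rewrite eI eL !inE => /eqP ei /eqP el.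
apply/(diam_component_leP Q_comp) => -[j|m] [j'|m'];
  rewrite !inE ?eI ?eL !inE => /eqP-> /eqP->; rewrite ?distxx //;
  by apply: dist_adj; rewrite /= -ei -el P0.
Qed.

Lemma verts1P (a : rees0 gT I L) :
  reflect (exists i x l, [/\ a = Some (i, x, l), inl i \in sides Q & inr l \in sides Q])
          (a \in verts1 gT Q).
Proof.
rewrite inE; case: a => [[[i x] l]|]; last by right=> -[? [? [? []]]].
by apply: (iffP andP) => [[iQ lQ]|[j [y [m [[-> _ ->]]]]]];
  [exists i, x, l | ]; rewrite !inE.
Qed.

(** For [D_Q >= 2] a pair walk of length [D_Q - 1] always exists: the ends it must join have
    distances of the parity of [D_Q - 1], so these cannot equal [D_Q]. The 1 in the maximum covers
    [D_Q = 1], where length 0 would not control the group coordinate. *)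
Lemma diam_component1_upper :
  diam (component1 P Q) <= maxn 1 (zero_diam Q).-1.
Proof.
apply/(diam_component_leP (verts1_component P_regular Q_closure)).
move=> _ _ /verts1P[i [x [l [-> iQ lQ]]]] /verts1P[j [y [m [-> jQ mQ]]]].
have upper n : 0 < n ->
    pair_walk P n i l j m -> dist H (Some (i, x, l)) (Some (j, y, m)) <= n.
  by case: n => // n _; apply: dist_pair_walk.
have le_pred u v : u \in sides Q -> v \in sides Q ->
    is_row u (+) is_row v = ~~ odd (zero_diam Q) -> dist Z u v <= (zero_diam Q).-1.
  move=> uQ vQ par; apply: leq_pred_parity; first exact: zero_dist_le.
  by rewrite (odd_zero_dist Q_closure).
have odd_pred : odd (zero_diam Q).-1 = ~~ odd (zero_diam Q).
  by rewrite -[in RHS](prednK zero_diam_gt0) /= negbK.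
have [D1|D1] := leqP (zero_diam Q) 1.
  apply: leq_trans (leq_maxl _ _); apply: upper => //.
  by rewrite /pair_walk /= !(zero_walkE Q_closure) //= !(leq_trans _ D1) // zero_dist_le.
apply: leq_trans (leq_maxr _ _); apply: upper; first by rewrite -ltnS (ltn_predK D1).
rewrite /pair_walk; case: ifP => par; rewrite !(zero_walkE Q_closure) // par /=;
  by rewrite !le_pred // -odd_pred par.
Qed.

(** Let [u], [v] realise [D_Q]. A neighbour [w] of [v] is at distance at least [D_Q - 1] from [u],
    and [v], [w] are the column and row of one vertex. Whatever the parity, the walker from [u] must
    reach [v] or [w]. *)
Lemma diam_component1_lower : (zero_diam Q).-1 <= diam (component1 P Q).
Proof.
have compQ := verts1_component P_regular Q_closure.
have in1 i x l : inl i \in sides Q -> inr l \in sides Q ->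
    (Some (i, x, l) : rees0 gT I L) \in verts1 gT Q.
  by move=> iQ lQ; apply/verts1P; exists i, x, l.
have neighbour_dist u v w : zero_adj P v w -> (dist Z u v).-1 <= dist Z u w.
  move=> vw; suff : dist Z u v <= (dist Z u w).+1 by lia.
  by rewrite dist_sym (dist_sym _ u); apply: dist_step.
have [u [v [uQ vQ eD]]] := diam_attained Q_comp; rewrite -/(zero_diam _) in eD.
rewrite -eD.
have [l0 [i0 [_ lQ0 iQ0]]] := closure_zero_entry Q_closure.
have [w wQ vw] := zero_neighbour Q_closure vQ.
have near := neighbour_dist u _ _ vw.
have ble := leq_pred (dist Z u v).
have [j [m [jQ mQ far_j far_m]]] : exists j m, [/\ inl j \in sides Q,
    inr m \in sides Q, (dist Z u v).-1 <= dist Z u (inl j)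
    & (dist Z u v).-1 <= dist Z u (inr m)].
  case: v w vQ wQ vw near ble {eD} => [j|m] [j'|m'] // vQ wQ _ near ble.
    by exists j, m'.
  by exists j', m.
have bound k : walk_of_length Z k u (inl j) || walk_of_length Z k u (inr m) ->
    (dist Z u v).-1 <= k.
  by case/orP => /dist_le_walk; apply: leq_trans.
have iQ0' : inl i0 \in sides Q by rewrite inE.
have lQ0' : inr l0 \in sides Q by rewrite inE.
(* The coordinate of the starting vertex other than [u] is arbitrary; [l0] or [i0] fills it. *)
case: u uQ {eD near ble far_j far_m} bound => [i|l] uQ bound.
  apply: (rees_dist_ge compQ (in1 i 1%g l0 uQ lQ0') (in1 j 1%g m jQ mQ)) => k.
  by rewrite /pair_walk; case: ifP => _ /andP[w1 _]; apply: bound; rewrite w1 ?orbT.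
apply: (rees_dist_ge compQ (in1 i0 1%g l iQ0' uQ) (in1 j 1%g m jQ mQ)) => k.
by rewrite /pair_walk; case: ifP => _ /andP[_ w1]; apply: bound; rewrite w1 ?orbT.
Qed.

Lemma diam_component1_gt0 : [set: gT] <> [set 1%g] -> 0 < diam (component1 P Q).
Proof.
move=> G1; have [l [i [P0 lQ iQ]]] := closure_zero_entry Q_closure.
have [x x1] : exists x : gT, x != 1%g.
  apply/existsP; apply: contra_notT G1 => /existsPn G1.
  by apply/setP => x; rewrite !inE; move: (G1 x); rewrite negbK => ->.
have comp := verts1_component P_regular Q_closure.
have in1 y : (Some (i, y, l) : rees0 gT I L) \in verts1 gT Q.
  by rewrite inE iQ.
apply: leq_trans (dist_le_diam comp (in1 x) (in1 1%g)); rewrite lt0n.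
apply: contraNneq x1 => d0.
have := walk_dist (component_connect comp (in1 x) (in1 1%g)).
by rewrite d0 walk0 => /eqP[->].
Qed.

Lemma diam_component1_trivial : [set: gT] = [set 1%g] -> zero_diam Q <= 1 ->
  diam (component1 P Q) = 0.
Proof.
move=> G1 /zero_diam_le1P[/eqP/cards1P[i eI] /eqP/cards1P[l eL]].
apply/eqP; rewrite -leqn0.
apply/(diam_component_leP (verts1_component P_regular Q_closure)).
move=> [[[j y] m]|] [[[j' y'] m']|]; rewrite !inE //= eI eL !inE.
move=> /andP[/eqP-> /eqP->] /andP[/eqP-> /eqP->].
have one (z : gT) : z = 1%g by apply/eqP; rewrite -in_set1 -G1 inE.
by rewrite (one y) (one y') distxx.
Qed.

End OneSubmatrix.

Lemma component2C Q M : component2 P Q M = component2 P M Q.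
Proof. by rewrite /component2 /verts2 setUC. Qed.

(** * The component determined by two distinct submatrices *)

Section TwoSubmatrices.

Variables (Q M : submatrix I L).
Hypotheses (Q_closure : is_closure_submatrix P Q)
           (M_closure : is_closure_submatrix P M)
           (QM_distinct : distinct_submatrices Q M).

Let QM_comp := verts2_component P_regular Q_closure M_closure.

Lemma zero_walk_distinct k u v : u \in sides Q -> v \in sides M ->
  walk_of_length Z k u v = false.
Proof.
move=> uQ vM; apply: contraTF vM => /connect_walk.
move=> /(component_closed (sides_component Q_closure) uQ).
by case: v => t; rewrite !inE;
  [move/(disjointFr QM_distinct.1)-> | move/(disjointFr QM_distinct.2)->].
Qed.

Lemma mem_verts2_l i x l : inl i \in sides Q -> inr l \in sides M ->
  (Some (i, x, l) : rees0 gT I L) \in verts2 gT Q M.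
Proof. by rewrite !inE => -> ->. Qed.

Lemma mem_verts2_r i x l : inl i \in sides M -> inr l \in sides Q ->
  (Some (i, x, l) : rees0 gT I L) \in verts2 gT Q M.
Proof. by rewrite !inE => -> ->; rewrite orbT. Qed.

(** Let [u], [v] realise [D_Q], and complete each to a vertex by an index of [M]. The walker from
    the index of [M] cannot enter [Q], which forces the parity, so the walker from [u] has to reach
    [v]. *)
Lemma zero_diam_le_component2 : zero_diam Q <= diam (component2 P Q M).
Proof.
have [l0 [i0 [_ lM0 iM0]]] := closure_zero_entry M_closure.
have iM : inl i0 \in sides M by rewrite inE.
have lM : inr l0 \in sides M by rewrite inE.
have [u [v [uQ vQ]]] := diam_attained (sides_component Q_closure).
rewrite -/(zero_diam _) => <-.
case: u v uQ vQ => [i|l] [j|m] uQ vQ.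
- apply: (rees_dist_ge QM_comp (mem_verts2_l 1%g uQ lM) (mem_verts2_l 1%g vQ lM)).
  move=> k; rewrite /pair_walk (zero_walk_distinct _ uQ lM) /=.
  by case: ifP => // _ /andP[/dist_le_walk].
- apply: (rees_dist_ge QM_comp (mem_verts2_l 1%g uQ lM) (mem_verts2_r 1%g iM vQ)).
  move=> k; rewrite /pair_walk (zero_walk_distinct _ uQ iM) /=.
  by case: ifP => // _ /andP[/dist_le_walk].
- apply: (rees_dist_ge QM_comp (mem_verts2_r 1%g iM uQ) (mem_verts2_l 1%g vQ lM)).
  move=> k; rewrite /pair_walk (zero_walk_distinct _ uQ lM) andbF.
  by case: ifP => // _ /andP[_ /dist_le_walk].
- apply: (rees_dist_ge QM_comp (mem_verts2_r 1%g iM uQ) (mem_verts2_r 1%g iM vQ)).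
  move=> k; rewrite /pair_walk (zero_walk_distinct _ uQ iM) andbF.
  by case: ifP => // _ /andP[_ /dist_le_walk].
Qed.

Lemma entry_distinct i l : inl i \in sides Q -> inr l \in sides M ->
  exists p, P l i = Some p.
Proof.
move=> iQ lM; case e: (P l i) => [p|]; first by exists p.
have := zero_walk_distinct 1 iQ lM.
by rewrite walk1 /= e.
Qed.

Lemma diam_component2_nonabelian :
  ~~ abelian [set: gT] -> 2 <= diam (component2 P Q M).
Proof.
rewrite /abelian => nab.
have /existsP[x /existsP[y xy]] : [exists x : gT, exists y : gT, (x * y != y * x)%g].
  apply: contraNT nab => /existsPn com; apply/centsP => x _ y _.
  by have /existsPn/(_ y) := com x; rewrite negbK => /eqP.
have [_ [i [_ _ iQ0]]] := closure_zero_entry Q_closure.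
have [l [_ [_ lM0 _]]] := closure_zero_entry M_closure.
have iQ : inl i \in sides Q by rewrite inE.
have lM : inr l \in sides M by rewrite inE.
have [p Pli] := entry_distinct iQ lM.
(* The factor [p^-1] cancels the matrix entry: the products of the two vertices have group
   coordinates [p^-1 * x * y] and [p^-1 * y * x]. *)
have aA := mem_verts2_l (p^-1 * x)%g iQ lM.
have bA := mem_verts2_l (p^-1 * y)%g iQ lM.
apply: leq_trans (dist_le_diam QM_comp aA bA).
have := walk_dist (component_connect QM_comp aA bA).
case: (dist _ _ _) => [|[|//]].
  by rewrite walk0 => /eqP[/mulgI e]; rewrite e eqxx in xy.
rewrite walk1 rees_adjE // => /andP[_] /=; rewrite Pli !mulgA !mulgK => /eqP[].
by rewrite -!mulgA => /mulgI e; rewrite e eqxx in xy.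
Qed.

(** The block containing [b] fixes the parity of the pair walk. Its length [k] is the largest number
    up to [n] of that parity, which still bounds the relevant distances. *)
Lemma dist_component2_le n i x l b :
  zero_diam Q <= n -> zero_diam M <= n -> abelian [set: gT] || (2 <= n) ->
  inl i \in sides Q -> inr l \in sides M -> b \in verts2 gT Q M ->
  dist H (Some (i, x, l)) b <= n.
Proof.
move=> DQ DM ab2 iQ lM; case: b => [[[j y] m]|]; last by rewrite !inE.
have n_gt0 : 0 < n := leq_trans (zero_diam_gt0 Q_closure) DQ.
have distQ u v : u \in sides Q -> v \in sides Q -> dist Z u v <= n.
  by move=> uQ vQ; apply: leq_trans DQ; apply: zero_dist_le.
have distM u v : u \in sides M -> v \in sides M -> dist Z u v <= n.
  by move=> uQ vQ; apply: leq_trans DM; apply: zero_dist_le.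
have upper k : k <= n -> 0 < k -> pair_walk P k i l j m ->
    dist H (Some (i, x, l)) (Some (j, y, m)) <= n.
  by case: k => // k le_k _ /dist_pair_walk le; apply: leq_trans le_k; apply: le.
rewrite !inE => /orP[]/andP[jS mS].
  have jQ : inl j \in sides Q by rewrite inE.
  have mM : inr m \in sides M by rewrite inE.
  have [k [le_kn ek le_k]] : exists k, [/\ k <= n, odd k = false &
      forall h, h <= n -> odd h = false -> h <= k].
    have [on|on] := boolP (odd n); last by exists n; split=> //; apply: negbTE.
    exists n.-1; split; first exact: leq_pred.
      by move: on; rewrite -{1}(prednK n_gt0) /= => /negbTE.
    by move=> h hn oh; apply: leq_pred_parity; rewrite ?oh ?on.
  have pw : pair_walk P k i l j m.
    rewrite /pair_walk ek (zero_walkE Q_closure) // (zero_walkE M_closure) // ek.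
    by rewrite !le_k ?(distQ _ _ iQ jQ) ?(distM _ _ lM mM)
      ?(odd_zero_dist Q_closure iQ jQ) ?(odd_zero_dist M_closure lM mM).
  (* For [k = 0] the vertices differ at most in the group coordinate. Then [n < 2], so [G] is
     abelian and they commute. *)
  have [k0|] := posnP k; last by move/(upper _ le_kn); apply.
  move: pw; rewrite k0 /pair_walk /= !walk0 => /andP[/eqP[<-] /eqP[<-]].
  have [<-|ne] := eqVneq x y; first by rewrite distxx.
  have ab : abelian [set: gT].
    case/orP: ab2 => // n2; have := le_k 2 n2 erefl; by rewrite k0.
  have [p Pli] := entry_distinct iQ lM.
  apply: leq_trans n_gt0; apply: dist_adj; rewrite rees_adjE //= Pli.
  apply/andP; split; first by apply: contra_neq ne => -[].
  have com (g h : gT) : (g * h = h * g)%g by apply: (centsP ab); rewrite inE.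
  by rewrite (com (x * p)%g) (com x p) mulgA.
have jM : inl j \in sides M by rewrite inE.
have mQ : inr m \in sides Q by rewrite inE.
have [k [le_kn ek le_k]] : exists k, [/\ k <= n, odd k = true &
    forall h, h <= n -> odd h = true -> h <= k].
  have [on|on] := boolP (odd n); first by exists n.
  exists n.-1; split; first exact: leq_pred.
    by move: on; rewrite -{1}(prednK n_gt0) /= negbK.
  by move=> h hn oh; apply: leq_pred_parity; rewrite ?oh ?on.
apply: (upper _ le_kn); first by case: (k) ek.
rewrite /pair_walk ek (zero_walkE Q_closure) // (zero_walkE M_closure) // ek.
by rewrite !le_k ?(distQ _ _ iQ mQ) ?(distM _ _ lM jM)
  ?(odd_zero_dist Q_closure iQ mQ) ?(odd_zero_dist M_closure lM jM).
Qed.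

End TwoSubmatrices.

Lemma diam_component2_le Q M n :
  is_closure_submatrix P Q -> is_closure_submatrix P M ->
  distinct_submatrices Q M ->
  zero_diam Q <= n -> zero_diam M <= n -> abelian [set: gT] || (2 <= n) ->
  diam (component2 P Q M) <= n.
Proof.
move=> clQ clM dQM DQ DM ab2.
have dMQ : distinct_submatrices M Q.
  by case: dQM => d d'; split; rewrite disjoint_sym.
apply/(diam_component_leP (verts2_component P_regular clQ clM)) => a b.
case: a => [[[i x] l]|]; last by rewrite !inE.
move=> + bS; rewrite !inE => /orP[]/andP[iS lS].
  by apply: (dist_component2_le clQ clM); rewrite // inE.
apply: (dist_component2_le clM clQ); rewrite ?in_sides_col ?in_sides_row //.
by rewrite /verts2 setUC.
Qed.

End Diameters.

(** * Comparison of the diameters, by the values of [D_Q], [D_M] and the type of [G] *)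

Theorem proposition4p23
  (gT : finGroupType) (I L : finType) (P : L -> I -> option gT)
  (I_nonempty : (0 < #|I|)%N) (L_nonempty : (0 < #|L|)%N)
  (P_regular : regular_matrix P)
  (P_zero : exists l i, P l i = None)
  (not_conn : ~ connected (rees0_graph P))
  (Q M : submatrix I L)
  (Q_closure : is_closure_submatrix P Q)
  (M_closure : is_closure_submatrix P M)
  (QM_distinct : distinct_submatrices Q M) :
  let special :=
    [/\ #|sub_cols Q| = 1%N, #|sub_rows Q| = 1%N,
        #|sub_cols M| = 1%N & #|sub_rows M| = 1%N]
    /\ ([set: gT] <> [set 1%g] /\ abelian [set: gT]) in
  (special -> diam (component2 P Q M) = 1%N) /\
  (~ special ->
     diam (component2 P Q M) =
       (1 + maxn (diam (component1 P Q)) (diam (component1 P M)))%N).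
Proof.
have DQ1 := zero_diam_gt0 Q_closure; have DM1 := zero_diam_gt0 M_closure.
have lowQ := zero_diam_le_component2 P_regular P_zero Q_closure M_closure QM_distinct.
have lowM : zero_diam P M <= diam (component2 P Q M).
  rewrite component2C; apply: zero_diam_le_component2 => //.
  by case: QM_distinct => d d'; split; rewrite disjoint_sym.
have up n := diam_component2_le (n := n) P_regular P_zero Q_closure M_closure QM_distinct.
move=> special; split=> [[[cQ rQ cM rM] [_ ab]]|nspecial].
  apply/eqP; rewrite eqn_leq (leq_trans DQ1 lowQ) andbT.
  by apply: up; rewrite ?ab //; apply/zero_diam_le1P.
have lQ := diam_component1_lower P_regular P_zero Q_closure.
have lM := diam_component1_lower P_regular P_zero M_closure.
have uQ := diam_component1_upper P_regular P_zero Q_closure.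
have uM := diam_component1_upper P_regular P_zero M_closure.
(* If the larger of [D_Q], [D_M] is at least 2, it equals the diameter of [C_QM], and its own
   component has diameter one less. A component with value 1 has diameter at most 1 and does not
   affect the maximum. *)
have [D2|] := leqP 2 (maxn (zero_diam P Q) (zero_diam P M)).
  have := up _ (leq_maxl _ _) (leq_maxr _ _); rewrite D2 orbT => /(_ isT) {}up.
  by clear -DQ1 DM1 lowQ lowM lQ lM uQ uM D2 up; lia.
rewrite ltnS geq_max => /andP[DQ DM].
have [cQ rQ] := zero_diam_le1P Q_closure DQ.
have [cM rM] := zero_diam_le1P M_closure DM.
(* Both submatrices are now 1 x 1. As the special case is excluded, an abelian [G] is trivial and
   the diameters are 0, 0 and 1; for non-abelian [G] they are 1, 1 and 2. *)
have [ab|nab] := boolP (abelian [set: gT]).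
  have G1 : [set: gT] = [set 1%g].
    by apply/eqP; apply/negPn/negP => /eqP G1; apply: nspecial.
  rewrite !diam_component1_trivial //.
  by apply/eqP; rewrite eqn_leq (leq_trans DQ1 lowQ) andbT; apply: up; rewrite ?ab.
have G1 : [set: gT] <> [set 1%g].
  by move=> e; move: nab; rewrite e abelian1.
have gQ := diam_component1_gt0 P_regular Q_closure G1.
have gM := diam_component1_gt0 P_regular M_closure G1.
have up2 := up 2 (leqW DQ) (leqW DM) (orbT _).
have low2 := diam_component2_nonabelian P_regular P_zero Q_closure M_closure QM_distinct nab.
by clear -DQ DM lQ lM uQ uM gQ gM up2 low2; lia.
Qed.
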